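(* Let $P$ be a simple $d$-polytope. Then every induced cycle of length $3$, $4$ or $5$ in the graph of $P$ is the graph of a $2$-face of $P$.
   Context: The graph of a polytope is the graph formed by its vertices and edges. A $d$-polytope (a polytope of dimension $d$) is simple if all its vertex figures are simplices, equivalently if each vertex is contained in exactly $d$ edges. A $2$-face is a face of dimension $2$ (possibly $P$ itself when $d=2$). An induced cycle in a graph is a cycle that equals the subgraph induced by its vertex set. *)

(* Defs.v *)
From mathcomp Require Import all_boot all_order all_algebra.
From mathcomp Require Import boolp classical_sets reals.

Set Implicit Arguments.
Unset Strict Implicit.
Unset Printing Implicit Defensive.

Import Order.TTheory GRing.Theory Num.Theory.

Local Open Scope classical_set_scope.
Local Open Scope ring_scope.

(* An edge {x, y} is represented by the two pairs (x, y) and (y, x). *)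
Record graph (T : Type) := Graph { verts : set T; adj : set (T * T) }.

Definition induced_subgraph (T : Type) (G : graph T) (A : set T) : graph T :=
  Graph (verts G `&` A) (adj G `&` (A `*` A)).

Definition cycle_graph (T : eqType) (s : seq T) : graph T :=
  Graph [set` s]
    [set e | (e.1 \in s /\ e.2 = next s e.1) \/
             (e.2 \in s /\ e.1 = next s e.2)].

Definition is_cycle (T : eqType) (k : nat) (C : graph T) : Prop :=
  exists s : seq T, [/\ (3 <= k)%N, size s = k, uniq s & C = cycle_graph s].

(* The equation also forces C to be a subgraph of G. *)
Definition induced_cycle (T : eqType) (G : graph T) (k : nat) (C : graph T) :
    Prop :=
  is_cycle k C /\ C = induced_subgraph G (verts C).

Section Polytopes.
Variables (R : realType) (n : nat).
Local Notation V := 'rV[R]_n.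
Implicit Types (P F Q S : set V) (v w x y c : V).

Definition dotp c x : R := (c *m x^T) 0 0.

Definition convex_hull S : set V :=
  [set y | exists m (p : 'I_m -> V) (l : 'I_m -> R),
    [/\ forall i, S (p i), forall i, 0 <= l i, \sum_i l i = 1
      & y = \sum_i l i *: p i]].

Definition affine_hull S : set V :=
  [set y | exists m (p : 'I_m -> V) (l : 'I_m -> R),
    [/\ forall i, S (p i), \sum_i l i = 1 & y = \sum_i l i *: p i]].

Definition affinely_independent m (p : 'I_m -> V) : Prop :=
  forall l : 'I_m -> R,
    \sum_i l i = 0 -> \sum_i l i *: p i = 0 -> forall i, l i = 0.

(* The empty set, of dimension -1, satisfies has_dim for no k. *)
Definition has_dim S (k : nat) : Prop :=
  exists (x : V) (U : {vspace V}),
    affine_hull S = [set x + u | u in [set` U]] /\ \dim U = k.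

Definition polytope P : Prop :=
  exists s : seq V, P = convex_hull [set` s].

(* With m = 0 this includes the empty simplex, which is the vertex figure of
   the only vertex of a 0-polytope. *)
Definition simplex P : Prop :=
  exists m (p : 'I_m -> V),
    affinely_independent p /\ P = convex_hull (range p).

(* The choices c = 0, b = 0 and c = 0, b = 1 give the faces P and set0. *)
Definition face P F : Prop :=
  exists (c : V) (b : R),
    (forall x, P x -> dotp c x <= b) /\ F = P `&` [set x | dotp c x = b].

Definition vertex P v : Prop := face P [set v].

Definition edge P F : Prop := face P F /\ has_dim F 1.

Definition two_face P F : Prop := face P F /\ has_dim F 2.

Definition polytope_graph P : graph V :=
  Graph (vertex P)
    [set e | [/\ vertex P e.1, vertex P e.2, e.1 <> e.2
               & exists F, [/\ edge P F, F e.1 & F e.2]]].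

Definition vertex_figure P v Q : Prop :=
  exists (c : V) (b : R),
    [/\ c != 0, dotp c v < b,
        forall w, vertex P w -> w <> v -> b < dotp c w
      & Q = P `&` [set x | dotp c x = b]].

Definition simple P : Prop :=
  forall v Q, vertex P v -> vertex_figure P v Q -> simplex Q.

End Polytopes.

(* Main.v *)
Require Import Defs.
From mathcomp Require Import all_boot all_order all_algebra.
From mathcomp Require Import boolp classical_sets reals.
From HB Require Import structures.
From mathcomp Require Import ring lra.

(** Everything is local at a vertex v of the simple polytope P. The vertex
    figure at v is a simplex with vertices v + q_1, ..., v + q_m, so the q_i
    are linearly independent and P lies in the cone v + cone(q_1, ..., q_m).
    Such a family, together with its dual functionals, is called a frame
    ([frame_exists]). Reading a face F containing v through the frame, F is
    determined by the set [dirs F v q] of those i with v + q_i in F, every set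
    of indices occurs, and the dimension of F is the number of its indices
    ([face_sub_dirs], [exists_face_dirs], [frame_dim]). The neighbours of v are
    the vertices of P on the rays from v along the q_i. Three facts follow.

    First, two edges at v lie in a common 2-face. Secondly, if a 2-face F and a
    face G share two nonadjacent vertices then F is contained in G: seen from
    one of the two vertices, the other has a nonzero coordinate along both
    directions of F, and both are therefore directions of G
    ([nonadjacent_two_face_sub]). Thirdly, a 2-face containing all the vertices
    of a cycle of the graph has exactly that cycle as its graph, because at
    each vertex of the cycle it lies in the cone of the two cycle edges, and a
    linear functional maximal at that vertex among the cycle vertices is then
    maximal on the whole face ([two_face_graph]).

    It remains to find a 2-face containing the given induced cycle. Let A_i be
    the 2-face spanned by the two cycle edges at the vertex v_i. For a triangle
    A_0 suffices. For a 4-cycle, the opposite vertices v_1 and v_3 lie in both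
    A_0 and A_2 and are nonadjacent, so A_2 is contained in A_0.

    For a 5-cycle, suppose that no 2-face contains all five vertices. By the
    second fact a face containing four of them contains the fifth, which makes
    the A_i pairwise distinct, and the 3-face H spanned by A_0 and A_1 contains
    the whole cycle and hence all A_i. Any two of the A_i share a vertex of the
    cycle; three edges of H leave it, and A_i and A_j have one of them in
    common, which lies in no third 2-face of H ([exists_edge_point]). So H is a
    3-polytope with five pairwise adjacent facets; planarity of its graph
    forbids this, and linear algebra gives a short proof. Five affine
    functions vanishing on the five facets and positive elsewhere on H satisfy
    a nontrivial linear relation, since affine functions on a 3-space form a
    4-dimensional space. Evaluated on the edge common to two facets, the
    relation has positive weights on the other three coefficients. Three of
    the five coefficients have the same weak sign, hence vanish, and then so
    do the other two ([no_five_neighbourly_faces]). *)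

Set Implicit Arguments.
Unset Strict Implicit.
Unset Printing Implicit Defensive.

Import Order.TTheory GRing.Theory Num.Theory.

Local Open Scope classical_set_scope.
Local Open Scope ring_scope.

(** * The scalar product as a linear functional *)

Section Dotp.
Variables (R : realType) (n : nat).
Local Notation V := 'rV[R]_n.
Implicit Types (c x : V).

Lemma dotp_is_linear c : scalar (@dotp R n c).
Proof.
by move=> a x y; rewrite /dotp linearP /= mulmxDr -scalemxAr !mxE.
Qed.

HB.instance Definition _ c :=
  GRing.isLinear.Build R V R *%R (@dotp R n c) (dotp_is_linear c).

Lemma dotpC c x : dotp c x = dotp x c.
Proof. by rewrite /dotp -[in LHS](trmxK c) -trmx_mul mxE. Qed.

Lemma dotpNl c x : dotp (- c) x = - dotp c x.
Proof. by rewrite ![dotp _ x]dotpC linearN. Qed.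

Lemma dotp_suml (I : finType) (A : {pred I}) (h : I -> V) x :
  dotp (\sum_(i in A) h i) x = \sum_(i in A) dotp (h i) x.
Proof.
by rewrite dotpC linear_sum; apply: eq_bigr => i _; rewrite dotpC.
Qed.

End Dotp.

(** * Convex hulls, faces and vertices *)

Section Convexity.
Variables (R : realType) (n : nat).
Local Notation V := 'rV[R]_n.
Implicit Types (S F G : set V) (v : V).

Definition segment_closed S : Prop :=
  forall x y t, S x -> S y -> 0 <= t -> t <= 1 -> S (x + t *: (y - x)).

Lemma sub_convex_hull S : S `<=` convex_hull S.
Proof.
move=> x Sx; exists 1, (fun=> x), (fun=> 1).
by split; rewrite ?big_ord1 ?scale1r.
Qed.

Lemma sub_affine_hull S : S `<=` affine_hull S.
Proof.
move=> x Sx; exists 1, (fun=> x), (fun=> 1).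
by split; rewrite ?big_ord1 ?scale1r.
Qed.

Lemma hull_segment_closed S : segment_closed (convex_hull S).
Proof.
move=> _ _ t [m [p [l [Sp l0 l1 ->]]]] [m' [p' [l' [Sp' l0' l1' ->]]]] t0 t1.
pose glue A (f : 'I_m -> A) (f' : 'I_m' -> A) i :=
  match split i with inl j => f j | inr j => f' j end.
have gl A f f' j : @glue A f f' (lshift m' j) = f j.
  by rewrite /glue -[lshift _ _]/(unsplit (inl j)) unsplitK.
have gr A f f' j : @glue A f f' (rshift m j) = f' j.
  by rewrite /glue -[rshift _ _]/(unsplit (inr j)) unsplitK.
exists (m + m')%N, (glue _ p p'),
  (glue _ (fun i => (1 - t) * l i) (fun i => t * l' i)).
split.
- by move=> i; rewrite /glue; case: split.
- move=> i; rewrite /glue; case: split => j; apply: mulr_ge0 => //; lra.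
- rewrite big_split_ord /=; under eq_bigr do rewrite gl.
  under [X in _ + X]eq_bigr do rewrite gr.
  by rewrite -!mulr_sumr l1 l1'; ring.
- rewrite big_split_ord /=; under [in RHS]eq_bigr do rewrite !gl -scalerA.
  under [X in _ = _ + X]eq_bigr do rewrite !gr -scalerA.
  by rewrite -!scaler_sumr scalerBr scalerBl scale1r -addrA [- _ + _]addrC.
Qed.

Lemma polytope_segment_closed S : polytope S -> segment_closed S.
Proof. by case=> s ->; exact: hull_segment_closed. Qed.

Lemma face_sub S F : face S F -> F `<=` S.
Proof. by move=> [c [b [_ ->]]] x []. Qed.

Lemma face_segment_closed S F :
  segment_closed S -> face S F -> segment_closed F.
Proof.
move=> cS [c [b [_ ->]]] x y t [Sx /= cx] [Sy /= cy] t0 t1; split=> /=.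
  exact: cS.
by rewrite linearD linearZ linearB /= cx cy; ring.
Qed.

(** A linear functional that attains its maximum inside a segment is
    constant on it. *)
Lemma face_segment_ends S F x y t :
    face S F -> S x -> S y -> 0 < t -> t < 1 -> F (x + t *: (y - x)) ->
  F x /\ F y.
Proof.
move=> [c [b [cb ->]]] Sx Sy t0 t1 [_ /=].
rewrite linearD linearZ linearB /= => e.
have := cb _ Sx; have := cb _ Sy => hy hx.
by split; split=> //=; nra.
Qed.

Lemma vertex_mem S v : vertex S v -> S v.
Proof. by move/face_sub; apply. Qed.

Lemma face_restrict S F G : face S G -> G `<=` F -> F `<=` S -> face F G.
Proof.
move=> [c [b [cb ->]]] GF FS; exists c, b; split; first by move=> x /FS /cb.
by apply/seteqP; split=> x [? ?]; split=> //; [exact: GF | exact: FS].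
Qed.

Lemma vertex_face S F v : F `<=` S -> vertex S v -> F v -> vertex F v.
Proof. by move=> FS vS Fv; apply: (face_restrict vS) => // _ ->. Qed.

(** In a convex combination equal to v, every point of positive weight
    attains the maximum of the functional exposing v, so it is v. *)
Lemma vertex_hull S v : vertex (convex_hull S) v -> S v.
Proof.
move=> vS; have [m [p [l [Sp l0 l1 ev]]]] := vertex_mem vS.
case: vS => c [b [cb e]].
have hS i : convex_hull S (p i) by exact: sub_convex_hull.
have vb : dotp c v = b.
  by have [] : (convex_hull S `&` [set x | dotp c x = b]) v by rewrite -e.
have /eqP : \sum_i l i * (b - dotp c (p i)) = 0.
  under eq_bigr do rewrite mulrBr.
  rewrite sumrB -mulr_suml l1 mul1r -[in b - _]vb ev linear_sum /=.
  by apply/eqP; rewrite subr_eq0; apply/eqP/eq_bigr => i _; rewrite linearZ.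
rewrite psumr_eq0 => [/allP l00|i _]; last first.
  by rewrite mulr_ge0 // subr_ge0 cb.
have [li|l0'] := pselect (forall i, l i = 0).
  by move: l1; rewrite big1 // => /esym/eqP; rewrite oner_eq0.
have /existsNP[i /eqP li] := l0'.
have := l00 i (mem_index_enum i).
rewrite mulf_eq0 (negPf li) subr_eq0 /= => /eqP bi.
have : [set v] (p i) by rewrite e; split=> /=.
by move=> <-.
Qed.

End Convexity.

(** * Frames of a polytope at a vertex *)

Section Frames.
Variables (R : realType) (n : nat).
Local Notation V := 'rV[R]_n.
Implicit Types (P S F G : set V) (v w x : V).

(** The q_i are linearly independent directions with dual functionals g_i,
    so that [dotp (g i) (x - v)] is the i-th coordinate of x seen from v.
    Only the directions that some point of S uses are required to stay in S:
    in this form a frame of a polytope at v is also a frame of each of its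
    faces containing v. *)
Definition frame S v m (q g : 'I_m -> V) : Prop :=
  [/\ S v,
      forall i j, dotp (g i) (q j) = (i == j)%:R,
      forall x, S x -> x - v = \sum_i dotp (g i) (x - v) *: q i,
      forall x i, S x -> 0 <= dotp (g i) (x - v)
    & forall x i, S x -> 0 < dotp (g i) (x - v) -> S (v + q i)].

Definition dirs S v m (q : 'I_m -> V) : {set 'I_m} :=
  [set i | `[< S (v + q i) >]]%SET.

(** The finitely many generators of a polytope can be cut off from a vertex
    by a level strictly between. *)
Lemma exists_separating_level (f : V -> R) a (s : seq V) :
  exists b, a < b /\ forall w, w \in s -> a < f w -> b < f w.
Proof.
elim: s => [|w s [b [ab bs]]]; first by exists (a + 1); split=> //; lra.
have [aw|wa] := ltP a (f w); last first.
  by exists b; split=> // x /[!inE] /orP[/eqP->|/bs//]; rewrite ltNge wa.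
exists (Num.min b ((a + f w) / 2)); split; first by rewrite lt_min ab; lra.
move=> x /[!inE] /orP[/eqP-> _|/bs xb /xb xb']; rewrite gt_min ?xb' //.
by apply/orP; right; lra.
Qed.

Lemma dual_family m (q : 'I_m -> V) :
    (forall l : 'I_m -> R, \sum_i l i *: q i = 0 -> forall i, l i = 0) ->
  exists g : 'I_m -> V, forall i j, dotp (g i) (q j) = (i == j)%:R.
Proof.
move=> freeq; pose Q := \matrix_i q i.
have /row_freeP[B QB] : row_free Q.
  rewrite -kermx_eq0; apply/rowV0P => u /sub_kermxP uQ.
  apply/rowP => i; rewrite mxE.
  apply: (freeq (fun i => u 0 i)); rewrite -[RHS]uQ mulmx_sum_row.
  by apply: eq_bigr => j _; rewrite rowK.
exists (fun i => (col i B)^T) => i j; rewrite dotpC /dotp trmxK.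
have := congr1 (fun M => fun_of_matrix M j i) QB; rewrite !mxE eq_sym => <-.
by apply: eq_bigr => k _; rewrite !mxE.
Qed.

(** Cut P just above v by a level set of a functional minimal only at v. The
    section is a simplex with vertices p_i, and q_i = p_i - v. A linear
    relation between the q_i has coefficients summing to 0, because the
    functional has the same nonzero value on all of them; affine
    independence of the p_i then kills it. Every generator of P other than v
    is seen from v through a point of the section, so P lies in the cone of
    the q_i. *)
Lemma frame_exists P v w :
    polytope P -> simple P -> vertex P v -> P w -> w <> v ->
  exists m (q g : 'I_m -> V), frame P v q g.
Proof.
move=> polP simP vP Pw wv; have cP := polytope_segment_closed polP.
case: (vP) => c0 [b0 [cb0 e0]]; pose c := - c0.
have Pv := vertex_mem vP.
(* The functional c is minimal on P exactly at v. *)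
have cv x : P x -> x <> v -> dotp c v < dotp c x.
  move=> Px xv; rewrite !dotpNl ltrN2.
  have [_ /= ->] : (P `&` [set x | dotp c0 x = b0]) v by rewrite -e0.
  rewrite lt_neqAle cb0 // andbT; apply/eqP => xb.
  by apply: xv; suff : [set v] x by []; rewrite e0.
case: polP => s Ps.
have sP x : x \in s -> P x.
  by rewrite Ps; exact: sub_convex_hull.
have [b [vb bs]] := exists_separating_level (dotp c) (dotp c v) s.
have /(simP _ _ vP)[m [p [pind Qp]]] :
    vertex_figure P v (P `&` [set x | dotp c x = b]).
  exists c, b; split=> //.
  - apply/eqP => c00; have := cv _ Pw wv.
    by rewrite c00 dotpC [dotp 0 w]dotpC !linear0 ltxx.
  - move=> x xP xv; apply: bs; last by apply: cv => //; exact: vertex_mem.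
    by rewrite Ps in xP; exact: vertex_hull xP.
have Qpi i : P (p i) /\ dotp c (p i) = b.
  suff : (P `&` [set x | dotp c x = b]) (p i) by [].
  by rewrite Qp; apply: sub_convex_hull; exists i.
pose q i := p i - v.
have freeq (l : 'I_m -> R) : \sum_i l i *: q i = 0 -> forall i, l i = 0.
  move=> lq; have lq' : \sum_i l i *: p i = (\sum_i l i) *: v.
    apply/eqP; rewrite -subr_eq0 scaler_suml -sumrB; apply/eqP.
    rewrite -[RHS]lq.
    by apply: eq_bigr => i _; rewrite scalerBr.
  have l0 : \sum_i l i = 0.
    have := congr1 (dotp c) lq'; rewrite linear_sum linearZ /=.
    under eq_bigr => i _ do rewrite linearZ /= (Qpi i).2.
    rewrite -mulr_suml => /eqP; rewrite -subr_eq0 -mulrBr mulf_eq0.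
    by rewrite subr_eq0 [b == _]gt_eqF // orbF => /eqP.
  by apply: pind => //; rewrite lq' l0 scale0r.
have [g gq] := dual_family freeq.
have gsum (l : 'I_m -> R) i : dotp (g i) (\sum_j l j *: q j) = l i.
  rewrite linear_sum (bigD1 i) //= big1 => [|j ji].
    by rewrite linearZ /= gq eqxx mulr1 addr0.
  by rewrite linearZ /= gq eq_sym (negPf ji) mulr0.
suff cone x : P x ->
    exists l : 'I_m -> R, (forall i, 0 <= l i) /\ x - v = \sum_i l i *: q i.
  exists m, q, g; split=> // [x Px|x i Px|x i Px _].
  - have [l [_ ->]] := cone x Px.
    by apply: eq_bigr => i _; rewrite gsum.
  - by have [l [l0 ->]] := cone x Px; rewrite gsum.
  - by rewrite /q addrC subrK; case: (Qpi i).
have cones y : y \in s ->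
    exists l : 'I_m -> R, (forall i, 0 <= l i) /\ y - v = \sum_i l i *: q i.
  move=> ys; have [->|yv] := eqVneq y v.
    exists (fun=> 0); split=> //; rewrite subrr big1 // => i _.
    by rewrite scale0r.
  have cvy : dotp c v < dotp c y by apply: cv; [exact: sP | exact/eqP].
  have bcy := bs _ ys cvy.
  (* The segment from v to y meets the cutting level at parameter t. *)
  pose t := (b - dotp c v) / (dotp c y - dotp c v).
  have d0 : 0 < dotp c y - dotp c v by rewrite subr_gt0.
  have t0 : 0 < t by rewrite divr_gt0 // subr_gt0.
  have t1 : t <= 1 by rewrite ler_pdivrMr //; lra.
  have : (P `&` [set x | dotp c x = b]) (v + t *: (y - v)).
    split=> /=; first by apply: cP => //; [exact: sP | exact: ltW].
    by rewrite linearD linearZ linearB /= /t; field; rewrite gt_eqF.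
  rewrite Qp => -[k [p' [l [p'p l0 l1 e]]]].
  have /choice[f fp] : forall i, exists j, p' i = p j.
    by move=> i; have [j _ <-] := p'p i; exists j.
  exists (fun j => t^-1 * \sum_(i | f i == j) l i); split=> [j|].
    by rewrite mulr_ge0 ?invr_ge0 ?sumr_ge0 ?ltW.
  under eq_bigr do rewrite -scalerA; rewrite -scaler_sumr.
  apply: (@scalerI _ _ t); first by rewrite gt_eqF.
  rewrite scalerA divff ?gt_eqF // scale1r.
  under eq_bigr do rewrite scaler_suml.
  have -> : t *: (y - v) = \sum_i l i *: (p' i - v).
    under eq_bigr do rewrite scalerBr.
    by rewrite sumrB -scaler_suml l1 scale1r -e addrAC subrr add0r.
  rewrite (partition_big f predT) //=; apply: eq_bigr => j _.
  by apply: eq_bigr => i /eqP <-; rewrite fp.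
move=> Px; rewrite Ps in Px; case: Px => k [p' [l [p's l0 l1 ->]]].
have /choice[h hP] : forall i, exists h : 'I_m -> R,
    (forall j, 0 <= h j) /\ p' i - v = \sum_j h j *: q j.
  by move=> i; apply: cones; exact: p's.
exists (fun j => \sum_i l i * h i j); split=> [j|].
  by apply: sumr_ge0 => i _; rewrite mulr_ge0 // (hP i).1.
under [RHS]eq_bigr do rewrite scaler_suml.
rewrite [RHS]exchange_big /=.
have -> : \sum_i l i *: p' i - v = \sum_i l i *: (p' i - v).
  under [RHS]eq_bigr do rewrite scalerBr.
  by rewrite sumrB -scaler_suml l1 scale1r.
apply: eq_bigr => i _; rewrite (hP i).2 scaler_sumr.
by apply: eq_bigr => j _; rewrite scalerA.
Qed.

Lemma has_dim_inj S k k' : has_dim S k -> has_dim S k' -> k = k'.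
Proof.
move=> [x [U [eU <-]]] [x' [U' [eU' <-]]].
rewrite eU in eU'.
have sub (a a' : V) (W W' : {vspace V}) :
    [set a + u | u in [set` W]] = [set a' + u | u in [set` W']] -> (W <= W')%VS.
  move=> e; apply/subvP => u uW.
  have [u1 /= u1W e1] : [set a' + u | u in [set` W']] (a + u).
    by rewrite -e; exists u.
  have [u2 /= u2W e2] : [set a' + u | u in [set` W']] a.
    by rewrite -e; exists 0; rewrite /= ?mem0v ?addr0.
  have -> : u = u1 - u2.
    by apply: (addrI a); rewrite -e1 -e2 -addrA [u2 + _]addrC subrK.
  exact: memvB.
congr (\dim _); apply/eqP.
by rewrite eqEsubv (sub _ _ _ _ eU') (sub _ _ _ _ (esym eU')).
Qed.

Lemma dirsP v m (q : 'I_m -> V) F i : reflect (F (v + q i)) (i \in dirs F v q).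
Proof. by rewrite inE; exact: asboolP. Qed.

Lemma dirs_sub v m (q : 'I_m -> V) F G :
  F `<=` G -> dirs F v q \subset dirs G v q.
Proof. by move=> FG; apply/fintype.subsetP => i /dirsP/FG ?; apply/dirsP. Qed.

Section Frame.
Variables (S : set V) (v : V) (m : nat) (q g : 'I_m -> V).
Hypothesis fr : frame S v q g.

Lemma frame_expand x :
  S x -> x - v = \sum_(i in dirs S v q) dotp (g i) (x - v) *: q i.
Proof.
case: fr => _ _ ex ge0 gt0 Sx; rewrite [LHS]ex // (bigID (mem (dirs S v q))) /=.
rewrite [X in _ + X]big1 ?addr0 // => i /dirsP iS.
case: (ltrgtP 0 (dotp (g i) (x - v))) => [/(gt0 x i Sx)//|h|<-].
  by have := ge0 x i Sx; rewrite leNgt h.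
by rewrite scale0r.
Qed.

Lemma frame_coord i j t : dotp (g i) (v + t *: q j - v) = t * (i == j)%:R.
Proof. by case: fr => _ gq _ _ _; rewrite addrAC subrr add0r linearZ /= gq. Qed.

Lemma frame_ray_dir i t : 0 < t -> S (v + t *: q i) -> i \in dirs S v q.
Proof.
case: fr => _ _ _ _ gt0 t0 Sx; apply/dirsP; apply: gt0 Sx _.
by rewrite frame_coord eqxx mulr1.
Qed.

(** A functional exposing F is nonpositive on the directions of S. If a
    point of F has a positive coordinate along q_i, the functional vanishes
    on q_i, and v + q_i is in F. *)
Lemma frame_face F : face S F -> F v -> frame F v q g.
Proof.
case: fr => Sv gq ex ge0 gt0 [c [b [cb ->]]] [_ /= vb].
split=> // [x [Sx _]|x i [Sx _]|x i [Sx /= xb] xi]; [exact: ex|exact: ge0|].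
split=> /=; first exact: gt0 xi.
have le0 j : 0 <= dotp (g j) (x - v) * - dotp c (q j).
  case: (ltrgtP 0 (dotp (g j) (x - v))) => [h|h|<-]; last by rewrite mul0r.
    apply: mulr_ge0; first exact: ltW.
    by have := cb _ (gt0 _ _ Sx h); rewrite linearD /= vb; lra.
  by have := ge0 x j Sx; rewrite leNgt h.
have /eqP : \sum_j dotp (g j) (x - v) * - dotp c (q j) = 0.
  have := congr1 (dotp c) (ex x Sx); rewrite linearB /= xb vb subrr linear_sum.
  move=> e; apply: oppr_inj; rewrite oppr0 [RHS]e -sumrN.
  by apply: eq_bigr => j _; rewrite linearZ /= mulrN opprK.
rewrite psumr_eq0 => [/allP/(_ i (mem_index_enum i))/=|//].
rewrite mulf_eq0 oppr_eq0 gt_eqF //= => /eqP cq.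
by rewrite linearD /= vb cq addr0.
Qed.

(** The exposing functional of F vanishes on the directions of F, so it has
    the same value at x as at v. *)
Lemma mem_face_dirs F x : face S F -> F v -> S x ->
  (forall i, 0 < dotp (g i) (x - v) -> i \in dirs F v q) -> F x.
Proof.
case: fr => _ _ ex ge0 _ [c [b [_ ->]]] [_ /= vb] Sx sub; split=> //=.
rewrite -[x](subrK v) linearD /= vb ex // linear_sum /= big1 ?add0r // => i _.
rewrite linearZ /=.
case: (ltrgtP 0 (dotp (g i) (x - v))) => [/sub/dirsP[_ /=]|h|<-].
- by rewrite linearD /= vb => e; rewrite (_ : dotp c _ = 0) ?mulr0 //; lra.
- by have := ge0 x i Sx; rewrite leNgt h.
- by rewrite mul0r.
Qed.

(** The affine hull of S is v plus the span of the q_i in [dirs S v q],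
    which are free by duality. *)
Lemma frame_dim : has_dim S #|dirs S v q|.
Proof.
pose J := dirs S v q.
pose X : #|J|.-tuple V := [tuple q (enum_val i) | i < #|J|].
have XE (i : 'I_#|J|) : X`_i = q (enum_val i).
  by rewrite -tnth_nth tnth_mktuple.
case: fr => Sv gq _ _ _.
exists v, <<X>>%VS; split; last first.
  suff /eqP -> : free X by rewrite size_tuple.
  apply/freeP => k k0 i.
  have := congr1 (dotp (g (enum_val i))) k0; rewrite linear0 linear_sum /=.
  rewrite (bigD1 i) //= big1 => [|j ji].
    by rewrite linearZ /= XE gq eqxx mulr1 addr0.
  by rewrite linearZ /= XE gq (inj_eq enum_val_inj) eq_sym (negPf ji) mulr0.
have qX i : i \in J -> q i \in <<X>>%VS.
  move=> iJ; rewrite -(enum_rankK_in iJ iJ) -XE.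
  by apply: memv_span; rewrite mem_nth ?size_tuple.
apply/seteqP; split=> [y [k [p [l [Sp l1 ->]]]]|_ [u uX <-]].
  exists (\sum_i l i *: (p i - v)) => /=.
    apply: memv_suml => i _; apply: memvZ; rewrite frame_expand //.
    by apply: memv_suml => j jJ; apply: memvZ; exact: qX.
  under eq_bigr do rewrite scalerBr.
  by rewrite sumrB -scaler_suml l1 scale1r addrC subrK.
have {}uX : u \in <<X>>%VS := uX.
pose a i : R := coord X i u.
pose p (i : 'I_#|J|.+1) : V :=
  if unlift ord0 i is Some j then v + q (enum_val j) else v.
pose l (i : 'I_#|J|.+1) : R :=
  if unlift ord0 i is Some j then a j else 1 - \sum_j a j.
exists #|J|.+1, p, l; split.
- move=> i; rewrite /p; case: unliftP => [j _|_] //.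
  by apply/(dirsP v q); exact: enum_valP.
- rewrite big_ord_recl {1}/l unlift_none.
  under [X in _ + X]eq_bigr do rewrite /l liftK.
  by rewrite subrK.
- rewrite big_ord_recl {1}/l {1}/p unlift_none.
  under [X in _ = _ + X]eq_bigr do rewrite /l /p liftK scalerDr.
  rewrite big_split /= -scaler_suml scalerBl scale1r addrA subrK.
  rewrite [in LHS](coord_span uX); congr (_ + _).
  by apply: eq_bigr => i _; rewrite XE.
Qed.

Lemma frame_card k : has_dim S k -> #|dirs S v q| = k.
Proof. exact: has_dim_inj frame_dim. Qed.

(** Minus the sum of the dual functionals outside J is maximal exactly on
    the points whose coordinates outside J vanish. *)
Lemma exists_face_dirs (J : {set 'I_m}) : J \subset dirs S v q ->
  exists F, [/\ face S F, F v & dirs F v q = J].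
Proof.
move=> JS; case: fr => Sv gq ex ge0 _.
pose c := - \sum_(i in ~: J) g i.
have cE x : dotp c x = - \sum_(i in ~: J) dotp (g i) x.
  by rewrite dotpNl dotp_suml.
have fF : face S (S `&` [set x | dotp c x = dotp c v]).
  exists c, (dotp c v); split=> // x Sx.
  rewrite -subr_le0 -linearB /= cE oppr_le0 sumr_ge0 // => i _; exact: ge0.
exists (S `&` [set x | dotp c x = dotp c v]); split=> //.
have cq i : dotp c (q i) = - (i \notin J)%:R.
  rewrite cE; congr (- _); under eq_bigr do rewrite gq.
  case: (boolP (i \in J)) => iJ; rewrite -?in_setC /=.
    by rewrite big1 // => j; case: eqVneq => // ->; rewrite inE iJ.
  rewrite (bigD1 i) ?inE //= eqxx big1 ?addr0 // => j /andP[_ /negPf->] //.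
apply/setP => i; apply/dirsP/idP => [[_ /=]|iJ].
  rewrite linearD /= cq; case: (i \in J) => //= /eqP.
  by rewrite -subr_eq0 addrAC subrr add0r oppr_eq0 oner_eq0.
split; first by have /(fintype.subsetP JS)/dirsP := iJ.
by rewrite /= linearD /= cq iJ oppr0 addr0.
Qed.

Lemma face_sub_dirs F G : face S F -> F v -> face S G -> G v ->
  dirs G v q \subset dirs F v q -> G `<=` F.
Proof.
move=> fF Fv fG Gv GF x Gx; apply: mem_face_dirs => //.
  exact: face_sub Gx.
have [_ _ _ _ gt0] := frame_face fG Gv.
by move=> i i0; apply: (fintype.subsetP GF); apply/dirsP; exact: gt0 i0.
Qed.

End Frame.
End Frames.

(** * Edges and 2-faces at a vertex *)

Section Rays.
Variables (R : realType) (n : nat).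
Local Notation V := 'rV[R]_n.
Implicit Types (P S F G H K : set V) (v w x y z : V).

(** Of two points on a ray from a point of S, the nearer one lies strictly
    between two points of S, so it is not a vertex. *)
Lemma vertex_ray_unique S v q y y' t t' : S v -> vertex S y -> vertex S y' ->
  0 < t -> 0 < t' -> y = v + t *: q -> y' = v + t' *: q -> y = y'.
Proof.
move=> Sv.
wlog tt' : y y' t t' / t < t' => [hw|] yS y'S t0 t'0 ey ey'.
  case: (ltrgtP t t') => h; last by rewrite ey ey' h.
    exact: (hw y y' t t').
  by apply/esym; exact: (hw y' y t' t).
suff [_ ->] : [set y] v /\ [set y] y' by [].
have u0 : 0 < t / t' by rewrite divr_gt0.
have u1 : t / t' < 1 by rewrite ltr_pdivrMr ?mul1r.
apply: (face_segment_ends yS Sv (vertex_mem y'S) u0 u1) => /=.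
rewrite ey' [v + _ - v]addrAC subrr add0r scalerA -mulrA mulVf ?gt_eqF //.
by rewrite mulr1 -ey.
Qed.

Section Frame.
Variables (S : set V) (v : V) (m : nat) (q g : 'I_m -> V).
Hypothesis fr : frame S v q g.

(** An edge is a face with one direction. *)
Lemma adj_ray y : adj (polytope_graph S) (v, y) ->
  exists i t, [/\ i \in dirs S v q, 0 < t & y = v + t *: q i].
Proof.
move=> [/= vS yS vy [F [[fF dF] /= Fv Fy]]].
have frF := frame_face fr fF Fv.
have /eqP/cards1P[i Fi] := frame_card frF dF.
have iF : i \in dirs F v q by rewrite Fi inE.
have ey : y = v + dotp (g i) (y - v) *: q i.
  apply: (addIr (- v)); rewrite [RHS]addrAC subrr add0r.
  by rewrite {1}(frame_expand frF Fy) Fi big_set1.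
exists i, (dotp (g i) (y - v)); split=> //.
  by apply/dirsP; apply: (face_sub fF); have /dirsP := iF.
have [_ _ _ ge0 _] := fr.
rewrite lt_neqAle ge0 ?andbT; last exact: vertex_mem.
by apply/eqP => e; apply: vy; rewrite ey -e scale0r addr0.
Qed.

Lemma face_ray F i t : face S F -> F v -> i \in dirs F v q -> 0 < t ->
  S (v + t *: q i) -> F (v + t *: q i).
Proof.
move=> fF Fv iF t0 Sx; apply: (mem_face_dirs fr) => // j.
by rewrite (frame_coord fr); case: eqVneq => [->|_] //; rewrite mulr0 ltxx.
Qed.

Lemma ray_adj y i t : vertex S v -> vertex S y -> 0 < t -> y = v + t *: q i ->
  adj (polytope_graph S) (v, y).
Proof.
move=> vS yS t0 ey; split=> //=.
  move=> e; have := frame_coord fr i i t.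
  rewrite -ey -e subrr linear0 eqxx mulr1 => t00.
  by rewrite -t00 ltxx in t0.
have Sy := vertex_mem yS.
have iS : i \in dirs S v q by apply: (frame_ray_dir fr t0); rewrite -ey.
have sub : [set i]%SET \subset dirs S v q by rewrite finset.sub1set.
have [F [fF Fv Fi]] := exists_face_dirs fr sub.
exists F; split=> //.
  split=> //; rewrite -(cards1 i) -Fi.
  exact: frame_dim (frame_face fr fF Fv).
by rewrite ey; apply: face_ray; rewrite -?ey // Fi inE.
Qed.

Lemma adj_two_rays y z :
    adj (polytope_graph S) (v, y) -> adj (polytope_graph S) (v, z) -> y <> z ->
  exists i j t t', [/\ [set i; j]%SET \subset dirs S v q, i != j,
    0 < t /\ 0 < t', y = v + t *: q i & z = v + t' *: q j].
Proof.
move=> vy vz yz.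
have [i [t [iS t0 ey]]] := adj_ray vy; have [j [t' [jS t'0 ez]]] := adj_ray vz.
case: vy => /= vS yS _ _; case: vz => /= _ zS _ _.
exists i, j, t, t'; split=> //.
  by apply/fintype.subsetP => k; rewrite in_set2 => /orP[]/eqP->.
apply/eqP => ij; rewrite -ij in ez.
exact: yz (vertex_ray_unique (vertex_mem vS) yS zS t0 t'0 ey ez).
Qed.

Lemma exists_two_face y z :
    adj (polytope_graph S) (v, y) -> adj (polytope_graph S) (v, z) -> y <> z ->
  exists F, [/\ two_face S F, F v, F y & F z].
Proof.
move=> vy vz /(adj_two_rays vy vz)[i [j [t [t' [sub ij [t0 t'0] ey ez]]]]].
have [F [fF Fv Fi]] := exists_face_dirs fr sub.
exists F; split=> //.
- split=> //; have <- : #|[set i; j]%SET| = 2%N by rewrite cards2 ij.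
  by rewrite -Fi; exact: frame_dim (frame_face fr fF Fv).
- case: vy => /= _ /vertex_mem yS _ _.
  by rewrite ey; apply: face_ray; rewrite -?ey ?Fi ?inE ?eqxx.
- case: vz => /= _ /vertex_mem zS _ _.
  by rewrite ez; apply: face_ray; rewrite -?ez ?Fi ?inE ?eqxx ?orbT.
Qed.

Lemma dim2_two_rays y z : has_dim S 2 ->
    adj (polytope_graph S) (v, y) -> adj (polytope_graph S) (v, z) -> y <> z ->
  exists i j t t', [/\ dirs S v q = [set i; j]%SET, i != j,
    0 < t /\ 0 < t', y = v + t *: q i & z = v + t' *: q j].
Proof.
move=> dS vy vz /(adj_two_rays vy vz)[i [j [t [t' [sub ij t0 ey ez]]]]].
exists i, j, t, t'; split=> //; apply/esym/eqP.
by rewrite eqEcard sub (frame_card fr dS) cards2 ij.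
Qed.

Lemma dim2_cone y z x : has_dim S 2 ->
    adj (polytope_graph S) (v, y) -> adj (polytope_graph S) (v, z) -> y <> z ->
    S x ->
  exists a b, [/\ 0 <= a, 0 <= b & x - v = a *: (y - v) + b *: (z - v)].
Proof.
move=> dS vy vz yz Sx.
have [i [j [t [t' [dE ij [t0 t'0] ey ez]]]]] := dim2_two_rays dS vy vz yz.
have [_ _ _ ge0 _] := fr.
exists (dotp (g i) (x - v) / t), (dotp (g j) (x - v) / t').
split; rewrite ?divr_ge0 ?ge0 ?ltW //.
rewrite {1}(frame_expand fr Sx) dE big_setU1 ?inE //= big_set1.
rewrite ey ez ![v + _ - v]addrAC subrr !add0r !scalerA.
by rewrite !divfK ?gt_eqF.
Qed.

Lemma dim2_nbrs y z w : has_dim S 2 ->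
    adj (polytope_graph S) (v, y) -> adj (polytope_graph S) (v, z) -> y <> z ->
    adj (polytope_graph S) (v, w) -> w = y \/ w = z.
Proof.
move=> dS vy vz yz vw.
have [i [j [t [t' [dE _ [t0 t'0] ey ez]]]]] := dim2_two_rays dS vy vz yz.
have [k [u [kS u0 ew]]] := adj_ray vw.
case: vy => /= vS yS _ _; case: vz => /= _ zS _ _; case: vw => /= _ wS _ _.
have Sv := vertex_mem vS.
move: kS; rewrite dE !inE => /orP[]/eqP ek; rewrite ek in ew; [left|right].
  exact: vertex_ray_unique Sv wS yS u0 t0 ew ey.
exact: vertex_ray_unique Sv wS zS u0 t'0 ew ez.
Qed.

End Frame.

Lemma face_adj S F v m (q g : 'I_m -> V) y : frame S v q g -> face S F ->
  F v -> F y -> adj (polytope_graph S) (v, y) -> adj (polytope_graph F) (v, y).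
Proof.
move=> fr fF Fv Fy vy; have [i [t [iS t0 ey]]] := adj_ray fr vy.
case: vy => /= vS yS _ _.
exact: (ray_adj (frame_face fr fF Fv) (vertex_face (face_sub fF) vS Fv)
  (vertex_face (face_sub fF) yS Fy) t0 ey).
Qed.

Lemma cards2_mem (T : finType) (A : {set T}) (w : T) : #|A| = 2 -> w \in A ->
  exists2 f, A = [set w; f]%SET & f != w.
Proof.
move=> A2 wA; have /eqP/cards1P[f ef] : #|A :\ w| = 1%N.
  by have := cardsD1 w A; rewrite A2 wA => /eqP; rewrite eqSS => /eqP <-.
exists f; first by rewrite -ef finset.setD1K.
have : f \in A :\ w by rewrite ef finset.in_set1.
by rewrite finset.in_setD1 => /andP[].
Qed.

(** Otherwise some direction j of F at x is not a direction of G. As y is in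
    G, its coordinate along j is zero, so y lies on the ray along the other
    direction of F and is a neighbour of x. *)
Lemma nonadjacent_two_face_sub P F G x y m (q g : 'I_m -> V) :
    frame P x q g -> vertex P x -> vertex P y ->
    x <> y -> ~ adj (polytope_graph P) (x, y) ->
    two_face P F -> face P G -> F x -> F y -> G x -> G y ->
  F `<=` G.
Proof.
move=> fr xP yP xy nadj [fF dF] fG Fx Fy Gx Gy.
have frF := frame_face fr fF Fx; have frG := frame_face fr fG Gx.
apply: (face_sub_dirs fr) => //; apply/negP => /negP/subsetPn[j jF jG].
have [i Fi ij] := cards2_mem (frame_card frF dF) jF.
have [_ _ _ ge0 _] := fr.
have Py := vertex_mem yP.
have j0 : dotp (g j) (y - x) = 0.
  apply/eqP; rewrite eq_le ge0 // andbT leNgt; apply/negP => j0.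
  by move/negP: jG; apply; apply/dirsP; have [_ _ _ _ /(_ y j Gy j0)] := frG.
have := frame_expand frF Fy.
rewrite Fi big_setU1 ?inE 1?eq_sym //= j0 scale0r add0r big_set1 => e.
have ey : y = x + dotp (g i) (y - x) *: q i by rewrite -e addrC subrK.
apply: nadj; apply: (ray_adj fr xP yP _ ey).
rewrite lt_neqAle ge0 // andbT; apply/eqP => i0.
by apply: xy; rewrite ey -i0 scale0r addr0.
Qed.

End Rays.

(** * 2-faces inside a 3-face *)

Section ThreeFaces.
Variables (R : realType) (n : nat).
Local Notation V := 'rV[R]_n.
Implicit Types (P S F G H K : set V) (v w x y z : V).

Section Frame.
Variables (P : set V) (v : V) (m : nat) (q g : 'I_m -> V).
Hypothesis fr : frame P v q g.

Lemma face_eq_dirs F G : face P F -> F v -> face P G -> G v ->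
  dirs F v q = dirs G v q -> F = G.
Proof.
move=> fF Fv fG Gv e.
by apply/seteqP; split; apply: (face_sub_dirs fr) => //; rewrite e.
Qed.

Lemma exists_face_join F G : face P F -> F v -> face P G -> G v ->
  exists H, [/\ face P H, H v, F `<=` H, G `<=` H
              & dirs H v q = dirs F v q :|: dirs G v q].
Proof.
move=> fF Fv fG Gv.
have sub : dirs F v q :|: dirs G v q \subset dirs P v q.
  by rewrite finset.subUset !dirs_sub //; exact: face_sub.
have [H [fH Hv He]] := exists_face_dirs fr sub.
exists H; split=> //; apply: (face_sub_dirs fr) => //; rewrite He.
  exact: finset.subsetUl.
exact: finset.subsetUr.
Qed.

(** With at most three directions at v, the two pairs of directions of F and
    G meet in one direction w, and no third pair inside [dirs H v q]
    contains w. The midpoint of the segment from v to v + q_w is taken since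
    a face through this inner point also contains v, and can be compared
    with F and G at v. *)
Lemma exists_edge_point H F G : segment_closed P -> face P H -> H v ->
    (#|dirs H v q| <= 3)%N -> two_face P F -> two_face P G ->
    F v -> G v -> F `<=` H -> G `<=` H -> F <> G ->
  exists x, [/\ F x, G x
    & forall K, two_face P K -> K `<=` H -> K x -> K = F \/ K = G].
Proof.
move=> cP fH Hv H3 [fF dF] [fG dG] Fv Gv FH GH FG.
have cF := frame_card (frame_face fr fF Fv) dF.
have cG := frame_card (frame_face fr fG Gv) dG.
have dFG : dirs F v q != dirs G v q.
  by apply/eqP => e; apply: FG; exact: face_eq_dirs e.
have /card_gt0P[w] : (0 < #|dirs F v q :&: dirs G v q|)%N.
  have U3 : (#|dirs F v q :|: dirs G v q| <= 3)%N.
    apply: leq_trans H3; apply: subset_leq_card.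
    by rewrite finset.subUset !dirs_sub.
  have := cardsUI (dirs F v q) (dirs G v q); rewrite cF cG => e.
  by rewrite -(ltn_add2l #|dirs F v q :|: dirs G v q|) addn0 e.
rewrite finset.in_setI => /andP[wF wG].
have other K : face P K -> has_dim K 2 -> K v -> w \in dirs K v q ->
    exists2 f, dirs K v q = [set w; f]%SET & f != w.
  move=> fK dK Kv; have cK := frame_card (frame_face fr fK Kv) dK.
  exact: cards2_mem.
have [f eF fw] := other F fF dF Fv wF.
have [h eG hw] := other G fG dG Gv wG.
have fh : f != h by apply: contraNneq dFG => e; rewrite eF eG e.
have [Pv Pw] : P v /\ P (v + q w).
  by split; [exact: face_sub Fv|apply: (face_sub fF); move/dirsP: wF].
have h0 : 0 < 2^-1 :> R by rewrite invr_gt0.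
have h1 : 2^-1 < 1 :> R by rewrite invf_lt1 // ltr1n.
exists (v + 2^-1 *: (v + q w - v)); split.
- apply: (face_segment_closed cP fF) => //; try exact: ltW.
  by move/dirsP: wF.
- apply: (face_segment_closed cP fG) => //; try exact: ltW.
  by move/dirsP: wG.
move=> K [fK dK] KH /(face_segment_ends fK Pv Pw h0 h1)[Kv Kw].
have wK : w \in dirs K v q by apply/dirsP.
have [k eK kw] := other K fK dK Kv wK.
have [kf|kf] := eqVneq k f.
  by left; apply: face_eq_dirs => //; rewrite eK eF kf.
have [kh|kh] := eqVneq k h.
  by right; apply: face_eq_dirs => //; rewrite eK eG kh.
(* Four distinct directions do not fit in H. *)
have : k |: (h |: (f |: [set w]%SET)) \subset dirs H v q.
  have := dirs_sub v q KH; have := dirs_sub v q FH; have := dirs_sub v q GH.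
  rewrite eF eG eK !finset.subUset !finset.sub1set.
  by move=> /andP[-> ->] /andP[_ ->] /andP[_ ->].
move/subset_leq_card; rewrite leqNgt => /negP[]; apply: leq_ltn_trans H3 _.
by rewrite !cardsU1 !inE !negb_or kw kf kh hw fw eq_sym fh cards1.
Qed.

End Frame.

(** On a k-dimensional set an affine function is given by its value at one
    point and its linear parts on k basis vectors, so more than k + 1 of
    them are linearly dependent. *)
Lemma exists_affine_relation H k m (c : 'I_m -> V) (b : 'I_m -> R) :
    has_dim H k -> (k.+1 < m)%N ->
  exists l : 'I_m -> R, (exists i, l i != 0) /\
    forall x, H x -> \sum_i l i * (b i - dotp (c i) x) = 0.
Proof.
move=> [x0 [U [eH dU]]] km.
pose e := vbasis U.
pose M := row_mx (\col_i (b i - dotp (c i) x0)) (\matrix_(i, j) dotp (c i) e`_j)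
  : 'M_(m, 1 + \dim U).
have /rowV0Pn[u /sub_kermxP uM u0] : kermx M != 0.
  rewrite kermx_eq0 -row_leq_rank -ltnNge.
  by apply: leq_ltn_trans (rank_leq_col _) _; rewrite dU.
exists (fun i => u 0 i); split.
  by have /rV0Pn[i ui] := u0; exists i.
move: uM; rewrite mul_mx_row -[X in _ = X -> _]row_mx0 => /eq_row_mx[u1 u2].
move=> x Hx.
have := sub_affine_hull Hx.
rewrite eH => -[y yU <-]; have {}yU : y \in U := yU.
have ey := coord_vbasis yU.
have s1 : \sum_i u 0 i * (b i - dotp (c i) x0) = 0.
  have := congr1 (fun M : 'M_(_, _) => M 0 0) u1.
  rewrite !mxE => e0; rewrite -[RHS]e0.
  by apply: eq_bigr => i _; rewrite mxE.
have s2 (j : 'I_(\dim U)) : \sum_i u 0 i * dotp (c i) e`_j = 0.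
  have := congr1 (fun M : 'M_(_, _) => M 0 j) u2.
  rewrite !mxE => e0; rewrite -[RHS]e0.
  by apply: eq_bigr => i _; rewrite mxE.
have s3 : \sum_i u 0 i * dotp (c i) y = 0.
  rewrite ey; under eq_bigr do rewrite linear_sum mulr_sumr.
  rewrite exchange_big /= big1 // => j _.
  transitivity (coord e j y * \sum_i u 0 i * dotp (c i) e`_j); last first.
    by rewrite s2 mulr0.
  rewrite mulr_sumr.
  by apply: eq_bigr => i _; rewrite linearZ /= mulrCA.
have e0 :
    \sum_i u 0 i * (b i - dotp (c i) x0) - \sum_i u 0 i * dotp (c i) y = 0.
  by rewrite s1 s3 subr0.
rewrite -[RHS]e0 -sumrB; apply: eq_bigr => i _.
by rewrite linearD /=; ring.
Qed.

End ThreeFaces.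

(** * Five pairwise adjacent facets *)

(** The coefficients of a relation between five affine functions, evaluated
    at points where exactly the i-th and the j-th function vanish and the
    others are positive. *)
Definition pair_relations (R : realType) (f : 'I_5 -> R) : Prop :=
  forall i j, i != j -> exists y : 'I_5 -> R,
    [/\ y i = 0, y j = 0, forall k, k != i -> k != j -> 0 < y k
      & \sum_k f k * y k = 0].

Lemma pair_relationsN (R : realType) (f : 'I_5 -> R) :
  pair_relations f -> pair_relations (fun k => - f k).
Proof.
move=> rel i j /rel[y [yi yj y0 ys]]; exists y; split=> //.
apply: oppr_inj; rewrite oppr0 -[RHS]ys -sumrN.
by apply: eq_bigr => k _; rewrite mulNr opprK.
Qed.

(** Three indices carry the positive weights of one of the relations; when
    the coefficients there are nonnegative, it is a vanishing sum of
    nonnegative terms. *)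
Lemma pair_relations_ge0 (R : realType) (f : 'I_5 -> R) (T : {set 'I_5}) :
    pair_relations f -> (2 < #|T|)%N -> (forall k, k \in T -> 0 <= f k) ->
  exists2 U : {set 'I_5}, #|U| = 3 & forall k, k \in U -> f k = 0.
Proof.
move=> rel /card_geqP[s [us s3 sT]] T0.
pose U := [set x in s]%SET.
have c3 : #|U| = 3 by rewrite cardsE; move/card_uniqP: us => ->.
have /eqP/cards2P[i [j [ij eC]]] : #|~: U| = 2%N.
  by have := cardsC U; rewrite c3 card_ord; case.
have [y [yi yj y0 ys]] := rel i j ij.
have inU k : k \in U = (k != i) && (k != j).
  by rewrite -[U]finset.setCK eC !inE negb_or.
exists U => // k kU.
have ge0 x : 0 <= f x * y x.
  have [xU|] := boolP (x \in U).
    apply: mulr_ge0; first by apply/T0/sT; move: xU; rewrite inE.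
    by move: xU; rewrite inU => /andP[? ?]; rewrite ltW ?y0.
  by rewrite inU negb_and !negbK => /orP[]/eqP->; rewrite ?yi ?yj mulr0.
move/eqP: ys; rewrite psumr_eq0 => [/allP/(_ k (mem_index_enum k))/=|x _ //].
move: kU; rewrite inU => /andP[? ?].
by rewrite mulf_eq0 orbC gt_eqF ?y0 // => /eqP.
Qed.

(** By the pigeonhole principle three of five numbers have the same weak
    sign, so they vanish. Each of the remaining two is the only possibly
    nonzero coefficient in a relation that omits the other. *)
Lemma pair_relations_eq0 (R : realType) (f : 'I_5 -> R) :
  pair_relations f -> forall i, f i = 0.
Proof.
move=> rel.
have [T T3 T0] :
    exists2 T : {set 'I_5}, #|T| = 3 & forall k, k \in T -> f k = 0.
  pose N := [set k | 0 <= f k]%SET.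
  have [N3|N3] := ltnP 2 #|N|.
    by apply: (pair_relations_ge0 rel N3) => k; rewrite inE.
  have /(pair_relations_ge0 (pair_relationsN rel))[] : (2 < #|~: N|)%N.
  - have := cardsC N; rewrite card_ord => e.
    by rewrite -(ltn_add2l #|N|) e (leq_ltn_trans (leq_add N3 (leqnn 2))).
  - by move=> k; rewrite !inE -ltNge oppr_ge0; exact: ltW.
  by move=> T T3 T0; exists T => // k /T0/eqP; rewrite oppr_eq0 => /eqP.
move=> k; have [/T0//|kT] := boolP (k \in T).
(* In the relation for k' and j only f k can be nonzero. *)
have /eqP/cards1P[k' ek'] : #|~: (k |: T)| = 1%N.
  have := cardsC (k |: T); rewrite cardsU1 kT T3 card_ord => /eqP.
  by rewrite eqn_add2l => /eqP.
have /card_gt0P[j jT] : (0 < #|T|)%N by rewrite T3.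
have inT x : x != k -> x != k' -> x \in T.
  move=> xk; apply: contraNT => xT.
  by rewrite -finset.in_set1 -ek' !inE negb_or xk xT.
have k'C : k' \in ~: (k |: T) by rewrite ek' finset.in_set1.
have k'j : k' != j.
  by apply: contraTneq k'C => ->; rewrite !inE jT orbT.
have kk' : k != k'.
  by apply: contraTneq k'C => <-; rewrite !inE eqxx.
have kj : k != j by apply: contraNneq kT => ->.
have [y [yi yj y0 ys]] := rel k' j k'j.
move: ys; rewrite (bigD1 k) //= big1 => [/eqP|x xk].
  by rewrite addr0 mulf_eq0 orbC gt_eqF ?y0 // => /eqP.
have [->|xk'] := eqVneq x k'; first by rewrite yi mulr0.
by rewrite (T0 x (inT x xk xk')) mul0r.
Qed.

Section Cycles.
Variables (R : realType) (n : nat).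
Local Notation V := 'rV[R]_n.
Implicit Types (P F G H : set V) (x y : V).

(** This replaces the nonplanarity of the complete graph on five vertices,
    to which five pairwise adjacent facets of a 3-polytope would give a
    planar drawing. *)
Lemma no_five_neighbourly_faces H k (F : 'I_5 -> set V) :
    has_dim H k -> (k <= 3)%N -> (forall i, face H (F i)) ->
    (forall i j, i != j -> exists x,
      [/\ F i x, F j x & forall k, F k x -> k = i \/ k = j]) ->
  False.
Proof.
move=> dH k3 fF pts.
have /choice[c] := fF; move=> /choice[b cb].
have [l [[i0 li0] rel]] : exists l : 'I_5 -> R, (exists i, l i != 0) /\
    forall x, H x -> \sum_i l i * (b i - dotp (c i) x) = 0.
  exact: exists_affine_relation dH _.
suff l0 i : l i = 0 by rewrite l0 eqxx in li0.
apply: pair_relations_eq0 => {i} i j /pts[x [Fi Fj Fk]].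
have Hx := face_sub (fF i) Fi.
have zero h : F h x -> b h - dotp (c h) x = 0.
  by rewrite (cb h).2 => -[_ /= ->]; rewrite subrr.
exists (fun h => b h - dotp (c h) x).
split; [exact: zero|exact: zero| |exact: rel].
move=> h hi hj; rewrite subr_gt0 lt_neqAle (cb h).1 // andbT.
apply/eqP => e; have /Fk : F h x by rewrite (cb h).2.
by case=> e'; [move: hi|move: hj]; rewrite e' eqxx.
Qed.

(** * 2-faces containing a cycle of the graph *)

Lemma adj_sym P x y :
  adj (polytope_graph P) (x, y) -> adj (polytope_graph P) (y, x).
Proof.
by move=> [/= vx vy xy [E [eE Ex Ey]]]; split=> //=; [exact: nesym|exists E].
Qed.

Lemma graph_frame P x y : polytope P -> simple P ->
    adj (polytope_graph P) (x, y) ->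
  exists m (q g : 'I_m -> V), frame P x q g.
Proof.
move=> polP simP [/= vx /vertex_mem vy xy _].
by apply: frame_exists vx vy _ => // e; exact: xy.
Qed.

(** Labelling a cycle by the integers modulo its length turns successors and
    predecessors into i + 1 and i - 1. *)
Definition labelled_cycle (T : Type) k (v : 'I_k.+3 -> T) : graph T :=
  Graph (range v)
    [set e | exists i, e = (v i, v (i + 1)) \/ e = (v (i + 1), v i)].

Lemma cycle_graph_labelled (s : seq V) k : size s = k.+3 -> uniq s ->
  exists2 v : 'I_k.+3 -> V, injective v & cycle_graph s = labelled_cycle v.
Proof.
move=> sk us; pose v (i : 'I_k.+3) := nth 0 s i.
have vs (i : 'I_k.+3) : v i \in s by rewrite mem_nth // sk.
have sv x : x \in s -> exists i, x = v i.
  move=> xs; have xk : (index x s < k.+3)%N by rewrite -sk index_mem.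
  by exists (Ordinal xk); rewrite /v /= nth_index.
have vnext i : next s (v i) = v (i + 1).
  rewrite next_nth vs /v index_uniq ?sk //.
  case: s sk {us vs sv v} => // y s [sk] /=.
  have [ik|ik] := ltnP i k.+2.
    rewrite modn_small ?addn1 //= (set_nth_default 0) ?sk //.
  have -> : nat_of_ord i = k.+2 by apply/eqP; rewrite eqn_leq ik -ltnS ltn_ord.
  by rewrite addn1 modnn /= nth_default ?sk.
exists v.
  by move=> i j /eqP; rewrite nth_uniq ?sk // => /eqP/val_inj.
congr Graph.
  apply/seteqP; split=> [x /= /sv[i ->]|x [i _ <-]]; [by exists i|exact: vs].
apply/seteqP; split=> [[x y] /= [[/sv[i ->] ->]|[/sv[i ->] ->]]|e] /=;
  last case=> i [->|->] /=.
- by exists i; left; rewrite vnext.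
- by exists i; right; rewrite vnext.
- by left; rewrite vnext.
- by right; rewrite vnext.
Qed.

Lemma succ_neq_pred k (i : 'I_k.+3) : i + 1 != i - 1.
Proof.
apply/eqP => e; have : (1 + 1 : 'I_k.+3) = 0.
  by apply: (addrI (i - 1)); rewrite addr0 -[RHS]e addrA subrK.
by move/(congr1 val); rewrite /= !modn_small.
Qed.

Section Polygon.
Variables (P : set V) (k : nat) (v : 'I_k.+3 -> V).
Hypotheses (polP : polytope P) (simP : simple P) (v_inj : injective v).
Hypothesis adjv : forall i, adj (polytope_graph P) (v i, v (i + 1)).

Lemma adjv_pred i : adj (polytope_graph P) (v i, v (i - 1)).
Proof. by have := adjv (i - 1); rewrite subrK => /adj_sym. Qed.

Lemma vertexv i : vertex P (v i).
Proof. by case: (adjv i). Qed.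

Lemma v_succ_pred i : v (i + 1) <> v (i - 1).
Proof. by move=> /v_inj/eqP; rewrite (negPf (succ_neq_pred i)). Qed.

Lemma exists_corner i :
  exists F, [/\ two_face P F, F (v i), F (v (i + 1)) & F (v (i - 1))].
Proof.
have [m [q [g fr]]] := graph_frame polP simP (adjv i).
apply: (exists_two_face fr (adjv i) (adjv_pred i)); exact: v_succ_pred.
Qed.

(** A vertex x of F is the only maximum on F of some functional. Let v i
    maximize it among the cycle vertices; since F is in the cone of the
    cycle edges at v i, it is maximal on F there, and x = v i. At a vertex
    of the cycle the two cycle edges are the only edges of F. *)
Lemma two_face_graph F : two_face P F -> (forall i, F (v i)) ->
  polytope_graph F = labelled_cycle v.
Proof.
move=> [fF dF] Fv.
have frF i : exists m (q g : 'I_m -> V), frame P (v i) q g /\ frame F (v i) q g.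
  have [m [q [g fr]]] := graph_frame polP simP (adjv i).
  by exists m, q, g; split=> //; exact: (frame_face fr fF (Fv i)).
have adjF i : adj (polytope_graph F) (v i, v (i + 1)).
  by have [m [q [g [fr _]]]] := frF i; exact: (face_adj fr fF).
have adjF' i : adj (polytope_graph F) (v i, v (i - 1)).
  have [m [q [g [fr _]]]] := frF i.
  by apply: (face_adj fr fF) => //; exact: adjv_pred.
have vertF x : vertex F x -> exists i, x = v i.
  move=> xF; case: (xF) => c [b [cb e]].
  have [i _ imax] :=
    @arg_maxP _ _ _ (0 : 'I_k.+3) xpredT (fun i => dotp c (v i)) isT.
  exists i; have [m [q [g [_ fr]]]] := frF i.
  have Fx := vertex_mem xF.
  have [a [a' [a0 a'0 ex]]] :=
    dim2_cone fr dF (adjF i) (adjF' i) (@v_succ_pred i) Fx.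
  have xb : dotp c x = b.
    by have [] : (F `&` [set x | dotp c x = b]) x by rewrite -e.
  have : dotp c (v i) = b.
    apply/eqP; rewrite eq_le cb //= -xb -subr_le0 -linearB /= ex.
    rewrite linearD !linearZ !linearB /=.
    have h j : dotp c (v j) <= dotp c (v i) := imax j isT.
    have := h (i + 1); have := h (i - 1) => h1 h2; nra.
  move=> vb; suff : [set x] (v i) by move=> /= ->.
  by rewrite e.
rewrite /polytope_graph /labelled_cycle; congr Graph.
  apply/seteqP; split=> [x /vertF[i ->]|_ [i _ <-]]; first by exists i.
  by case: (adjF i).
apply/seteqP; split=> [[x y] xy|e [i [->|->]]]; last 2 first.
- exact: adjF.
- by apply: adj_sym; exact: adjF.
have [i ei] : exists i, x = v i by apply: vertF; case: xy.
have {}xy : adj (polytope_graph F) (x, y) := xy.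
rewrite ei in xy *; have [m [q [g [_ fr]]]] := frF i.
have [->|->] := dim2_nbrs fr dF (adjF i) (adjF' i) (@v_succ_pred i) xy.
  by exists i; left.
by exists (i - 1); right; rewrite subrK.
Qed.

End Polygon.
End Cycles.

(** * Induced cycles of length 3, 4 and 5 *)

Section InducedCycles.
Variables (R : realType) (n : nat).
Local Notation V := 'rV[R]_n.
Implicit Types (P F G H : set V) (x y : V).

Lemma I5_cases (i j : 'I_5) :
  j = i \/ j = i + 1 \/ j = i - 1 \/ j = i + 1 + 1 \/ j = i - 1 - 1.
Proof.
have : j - i = 0 \/ j - i = 1 \/ j - i = - 1 \/
    j - i = 1 + 1 \/ j - i = - 1 - 1.
  move: (j - i) => [[|[|[|[|[|//]]]]] lt];
    by [left; exact: val_inj | right; left; exact: val_inj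
       | right; right; left; exact: val_inj
       | right; right; right; left; exact: val_inj
       | right; right; right; right; exact: val_inj].
have : j = j - i + i by rewrite subrK.
move=> ej [|[|[|[|]]]] e; rewrite e ?add0r in ej.
- by left.
- by right; left; rewrite ej addrC.
- by right; right; left; rewrite ej addrC.
- by right; right; right; left; rewrite ej addrC addrA.
- by right; right; right; right; rewrite ej addrC addrA.
Qed.

Lemma I5_pred3 (i : 'I_5) : i - 1 - 1 - 1 = i + 1 + 1.
Proof.
rewrite -!addrA; congr (i + _); exact: val_inj.
Qed.

Section Corners.
Variables (P : set V) (k : nat) (v : 'I_k.+4 -> V).
Hypotheses (polP : polytope P) (simP : simple P) (v_inj : injective v).
Hypothesis adjv : forall i, adj (polytope_graph P) (v i, v (i + 1)).
Hypothesis inducedv : forall i j, adj (polytope_graph P) (v i, v j) ->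
  j = i + 1 \/ i = j + 1.

(** In an induced cycle of length at least 4 the two neighbours of a vertex
    are not adjacent. *)
Lemma corner_sub F G i : two_face P F -> F (v (i - 1)) -> F (v (i + 1)) ->
  face P G -> G (v (i - 1)) -> G (v (i + 1)) -> F `<=` G.
Proof.
move=> dF F0 F1 fG G0 G1.
have [m [q [g fr]]] := graph_frame polP simP (adjv (i - 1)).
apply: (nonadjacent_two_face_sub fr _ _ _ _ dF fG F0 F1 G0 G1).
- exact: (vertexv adjv).
- exact: (vertexv adjv).
- by apply/nesym/(v_succ_pred v_inj).
move=> /inducedv[e|e].
  (* An edge between the two neighbours would give 1 = 0 or 3 = 0 modulo
     the length. *)
  have : (1 : 'I_k.+4) = 0 by apply: (addrI i); rewrite addr0 e subrK.
  by move/(congr1 val).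
have : (1 + 1 + 1 : 'I_k.+4) = 0.
  by apply: (addrI (i - 1)); rewrite addr0 [RHS]e !addrA subrK.
by move/(congr1 val); rewrite /= !modn_small.
Qed.

Lemma face_fill G i :
  face P G -> G (v (i - 1)) -> G (v (i + 1)) -> G (v i).
Proof.
move=> fG G0 G1.
have [F [dF Fi F1 F0]] := exists_corner polP simP v_inj adjv i.
exact: corner_sub dF F0 F1 fG G0 G1 _ Fi.
Qed.

End Corners.

Section Pentagon.
Variables (P : set V) (v : 'I_5 -> V).
Hypotheses (polP : polytope P) (simP : simple P) (v_inj : injective v).
Hypothesis adjv : forall i, adj (polytope_graph P) (v i, v (i + 1)).
Hypothesis inducedv : forall i j, adj (polytope_graph P) (v i, v j) ->
  j = i + 1 \/ i = j + 1.

Let fill := @face_fill P 1 v polP simP v_inj adjv inducedv.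

(** After filling in the last vertex, which lies between two known ones, the
    whole cycle is in G. *)
Lemma face_four G i : face P G -> G (v (i - 1)) -> G (v i) -> G (v (i + 1)) ->
  G (v (i + 1 + 1)) \/ G (v (i - 1 - 1)) -> forall j, G (v j).
Proof.
move=> fG Gp Gi Gs G2 j.
have e : i + 1 + 1 + 1 = i - 1 - 1 by rewrite -(I5_pred3 i) subrK.
have [Gss Gpp] : G (v (i + 1 + 1)) /\ G (v (i - 1 - 1)).
  case: G2 => h; split=> //; apply: fill => //.
  - by rewrite I5_pred3.
  - by rewrite subrK.
  - by rewrite addrK.
  - by rewrite e.
by case: (I5_cases i j) => [->|[->|[->|[->|->]]]].
Qed.

(** By contradiction: five distinct corner 2-faces would be pairwise
    adjacent facets of a 3-dimensional face. *)
Lemma exists_pentagon : exists2 F, two_face P F & forall i, F (v i).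
Proof.
apply: contrapT => noF.
have /choice[A cA] := exists_corner polP simP v_inj adjv.
have A2 i : two_face P (A i) by case: (cA i).
have fA i : face P (A i) by case: (A2 i).
have A0 i : A i (v i) by case: (cA i).
have As i : A i (v (i + 1)) by case: (cA i).
have Ap i : A i (v (i - 1)) by case: (cA i).
have not4 i : ~ (A i (v (i + 1 + 1)) \/ A i (v (i - 1 - 1))).
  move=> h; apply: noF; exists (A i) => //.
  exact: face_four (fA i) (Ap i) (A0 i) (As i) h.
have A_inj i j : A i = A j -> j = i.
  move=> e; case: (I5_cases i j) => [//|[|[|[|]]]] ej;
    case: (not4 i); rewrite e.
  - by left; rewrite -ej.
  - by right; rewrite -ej.
  - by left; rewrite -ej.
  - by right; rewrite -ej.
have shared i j : exists l, A i (v l) /\ A j (v l).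
  case: (I5_cases i j) => [|[|[|[|]]]] ->; first by exists i.
  - by exists i; split=> //; rewrite -[X in v X](addrK 1).
  - by exists i; split=> //; rewrite -[X in v X](subrK 1).
  - by exists (i + 1); split=> //; rewrite -[X in v X](addrK 1).
  - by exists (i - 1); split=> //; rewrite -[X in v X](subrK 1).
(* The 3-face H is spanned by the corners at two consecutive vertices, which
   share the direction of the edge joining them. *)
pose i := (0 : 'I_5).
have [m [q [g fr]]] := graph_frame polP simP (adjv i).
have A1i : A (i + 1) (v i) by rewrite -[X in v X](addrK 1).
have [H [fH Hi AH A1H dH]] :=
  exists_face_join fr (fA i) (A0 i) (fA (i + 1)) A1i.
have Hv : forall j, H (v j).
  apply: (face_four fH (AH _ (Ap i)) Hi (AH _ (As i))).
  by left; exact: A1H.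
have AsubH j : A j `<=` H.
  exact: (corner_sub polP simP v_inj adjv inducedv (A2 j) (Ap j) (As j) fH).
have H3 : (#|dirs H (v i) q| <= 3)%N.
  have [w [t [_ t0 ew]]] := adj_ray fr (adjv i).
  have frA := frame_face fr (fA i) (A0 i).
  have frA1 := frame_face fr (fA (i + 1)) A1i.
  have wA : w \in dirs (A i) (v i) q.
    by apply: (frame_ray_dir frA t0); rewrite -ew.
  have wA1 : w \in dirs (A (i + 1)) (v i) q.
    by apply: (frame_ray_dir frA1 t0); rewrite -ew.
  have I1 : (0 < #|dirs (A i) (v i) q :&: dirs (A (i + 1)%R) (v i) q|)%N.
    by apply/card_gt0P; exists w; rewrite finset.in_setI wA.
  have := cardsUI (dirs (A i) (v i) q) (dirs (A (i + 1)) (v i) q).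
  rewrite (frame_card frA (A2 i).2) (frame_card frA1 (A2 (i + 1)).2) => e.
  by rewrite dH -(leq_add2r 1) (leq_trans _ (eq_leq e)) ?leq_add2l.
have dimH := frame_dim (frame_face fr fH Hi).
apply: (no_five_neighbourly_faces dimH H3 (F := A)).
  by move=> j; exact: face_restrict (fA j) (AsubH j) (face_sub fH).
move=> j l jl; have [w [Aj Al]] := shared j l.
have [m' [q' [g' fr']]] := graph_frame polP simP (adjv w).
have H3' : (#|dirs H (v w) q'| <= 3)%N.
  apply: leq_trans H3; by rewrite (frame_card (frame_face fr' fH (Hv w)) dimH).
have Ajl : A j <> A l by move=> /A_inj e; rewrite e eqxx in jl.
have [x [Ajx Alx Ax]] := exists_edge_point fr' (polytope_segment_closed polP)
  fH (Hv w) H3' (A2 j) (A2 l) Aj Al (AsubH j) (AsubH l) Ajl.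
exists x; split=> // h Ahx.
by have [/A_inj ->|/A_inj ->] := Ax (A h) (A2 h) (AsubH h) Ahx; [left|right].
Qed.

End Pentagon.

End InducedCycles.

Theorem proposition1p14 (R : realType) (n d : nat) (P : set 'rV[R]_n)
    (polP : polytope P) (dimP : has_dim P d) (simpleP : simple P)
    (k : nat) (hk : k = 3 \/ k = 4 \/ k = 5)
    (C : graph 'rV[R]_n) (hC : induced_cycle (polytope_graph P) k C) :
  exists F : set 'rV[R]_n, two_face P F /\ C = polytope_graph F.
Proof.
move: hC => [[s [k3 sk us Cs]] Cind].
case: k k3 hk sk => [//|[//|[//|k]]] _ hk sk.
have [v v_inj Cv] := cycle_graph_labelled sk us.
have adjE i j : adj C (v i, v j) <-> adj (polytope_graph P) (v i, v j).
  rewrite Cind; split=> [[]//|h]; split=> //.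
  by rewrite Cs Cv; split=> /=; [exists i|exists j].
have adjv i : adj (polytope_graph P) (v i, v (i + 1)).
  by apply/adjE; rewrite Cs Cv; exists i; left.
have inducedv i j : adj (polytope_graph P) (v i, v j) -> j = i + 1 \/ i = j + 1.
  move=> /adjE; rewrite Cs Cv => -[l []] [/v_inj -> /v_inj ->].
    by left.
  by right.
suff [F dF Fv] : exists2 F, two_face P F & forall i, F (v i).
  by exists F; rewrite Cs Cv (two_face_graph polP simpleP v_inj adjv dF Fv).
(* The corner at one vertex works for triangles and, after filling in the
   opposite vertex, for 4-cycles. *)
case: hk => [|[|]] [ek]; subst k; last exact: exists_pentagon.
  have [F [dF F0 F1 F2]] := exists_corner polP simpleP v_inj adjv 0.
  exists F => // -[[|[|[|//]]] lt].
  - by rewrite (_ : Ordinal _ = 0) //; exact: val_inj.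
  - by rewrite (_ : Ordinal _ = 0 + 1) //; exact: val_inj.
  - by rewrite (_ : Ordinal _ = 0 - 1) //; exact: val_inj.
have [F [dF F0 F1 F2]] := exists_corner polP simpleP v_inj adjv 0.
have fF : face P F by case: dF.
exists F => // -[[|[|[|[|//]]]] lt].
- by rewrite (_ : Ordinal _ = 0) //; exact: val_inj.
- by rewrite (_ : Ordinal _ = 0 + 1) //; exact: val_inj.
- rewrite (_ : Ordinal _ = 0 + 1 + 1); last exact: val_inj.
  apply: (face_fill polP simpleP v_inj adjv inducedv fF).
    by rewrite addrK.
  by rewrite (_ : 0 + 1 + 1 + 1 = 0 - 1) //; exact: val_inj.
- by rewrite (_ : Ordinal _ = 0 - 1) //; exact: val_inj.
Qed.
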